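(* Let $\mathcal X$ be a finite cell complex over a field $\mathbb K$ with associated chain complex $(C(\mathcal X),\partial)$. Let $\mathsf L$ be a finite distributive lattice with partial order $\leq$ defined by $a\leq b$ if and only if $a=a\wedge b$. Let $\{\mathcal X^a\subset\mathcal X\mid a\in\mathsf L\}$ be a lattice of closed subcomplexes of $\mathcal X$, with operations $\cap$ and $\cup$ and minimal and maximal elements $\varnothing$ and $\mathcal X$ respectively, such that $a\mapsto\mathcal X^a$ is a lattice isomorphism. Let $$\Delta\colon\bigoplus_{a\in\mathsf J(\mathsf L)}H_\bullet(\mathcal X^a,\mathcal X^{\overleftarrow a})\to\bigoplus_{a\in\mathsf J(\mathsf L)}H_\bullet(\mathcal X^a,\mathcal X^{\overleftarrow a})$$ be an associated connection matrix. For $a\in\mathsf L$ define $$M^a:=\bigoplus_{\{b\in\mathsf J(\mathsf L)\mid b\leq a\}}H_\bullet(\mathcal X^b,\mathcal X^{\overleftarrow b}),$$ a subcomplex of $(M,\Delta)$, where $M=M^{1_{\mathsf L}}$. Then the persistent homology groups of $\{M^a\}_{a\in\mathsf L}$ and $\{\mathcal X^a\}_{a\in\mathsf L}$ are isomorphic: for all $a\leq b$ in $\mathsf L$ and all $j\in\mathbb Z$, $$\operatorname{im}\big(H_j(M^a)\to H_j(M^b)\big)\cong\operatorname{im}\big(H_j(C(\mathcal X^a))\to H_j(C(\mathcal X^b))\big),$$ where the maps are induced by inclusions.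
   Context: Cell complex: a finite poset $(\mathcal X,\leq)$ with an order-preserving map $\dim\colon\mathcal X\to\mathbb N$ and a function $\kappa\colon\mathcal X\times\mathcal X\to\mathbb K$ such that $\kappa(\xi,\xi')\neq0$ implies $\xi'\leq\xi$ and $\dim\xi=\dim\xi'+1$, and $\sum_{\xi'}\kappa(\xi,\xi')\kappa(\xi',\xi'')=0$ for all $\xi,\xi''$. The associated chain complex $C(\mathcal X)$ has $C_n(\mathcal X)$ with basis the cells of dimension $n$, and $\partial\xi=\sum_{\xi'}\kappa(\xi,\xi')\xi'$. A closed subcomplex is a down-set $\mathcal K$ of $(\mathcal X,\leq)$ with the restricted data; then $C(\mathcal K)=\operatorname{span}\mathcal K$ is a subcomplex of $C(\mathcal X)$. For closed $\mathcal K'\subset\mathcal K$, $H_\bullet(\mathcal K,\mathcal K')$ is the homology of $C(\mathcal K)/C(\mathcal K')$. $\mathsf J(\mathsf L)$ is the poset (with the restricted order) of join-irreducible elements of $\mathsf L$, i.e. those elements $a$ having a unique predecessor (element covered by $a$), denoted $\overleftarrow a$. Connection matrix: put $M=\bigoplus_{p\in\mathsf J(\mathsf L)}M^{(p)}$ with $M^{(p)}=H_\bullet(\mathcal X^p,\mathcal X^{\overleftarrow p})$ (a graded vector space). A degree $-1$ map $\Delta\colon M\to M$ with $\Delta^2=0$ is an associated connection matrix if (i) $\Delta$ is $\mathsf J(\mathsf L)$-filtered: its component $\Delta^{pq}\colon M^{(q)}\to M^{(p)}$ is nonzero only if $p\leq q$; (ii) it is strict: $\Delta^{pp}=0$ for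 all $p$; (iii) the complexes $(M,\Delta)$ with the subcomplexes $M^a$ ($a\in\mathsf L$), and $C(\mathcal X)$ with the subcomplexes $C(\mathcal X^a)$ ($a\in\mathsf L$), are $\mathsf L$-filtered chain equivalent: there are chain maps in both directions, mutually inverse up to chain homotopy, such that the chain maps and the homotopies all carry the subspace indexed by $a$ into the subspace indexed by $a$, for every $a\in\mathsf L$. *)

(* Defs.v *)
From HB Require Import structures.
From mathcomp Require Import all_boot all_order all_algebra.

Set Implicit Arguments.
Unset Strict Implicit.
Unset Printing Implicit Defensive.

Import Order.TTheory GRing.Theory VectorInternalTheory.
Local Open Scope ring_scope.

Definition isomorphic (K : fieldType) (U V : vectType K) : Prop :=
  exists f : 'Hom(U, V), bijective f.

(* The type of cosets of the subgroup U, from ring_quotient, equipped with its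
   vector space structure. *)
Definition quotv (K : fieldType) (V : vectType K) (U : {vspace V}) : Type :=
  Quotient.quot (pred_of_vspace U : zmodClosed V).

Section QuotientSpace.
Variables (K : fieldType) (V : vectType K) (U : {vspace V}).
Local Notation Q := (quotv U).
Local Open Scope quotient_scope.

HB.instance Definition _ := GRing.Zmodule.copy Q (Quotient.quot (pred_of_vspace U)).

Definition quotv_class (v : V) : Q := \pi_(Quotient.quot (pred_of_vspace U)) v.
Definition quotv_repr (q : Q) : V := repr (q : Quotient.quot (pred_of_vspace U)).

Lemma quotv_reprK : cancel quotv_repr quotv_class.
Proof. by move=> q; rewrite /quotv_class /quotv_repr reprK. Qed.

Lemma quotv_classP u v : reflect (quotv_class u = quotv_class v) (u - v \in U).
Proof. by rewrite Quotient.idealrBE; apply: eqP. Qed.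

Lemma quotv_classD u v : quotv_class (u + v) = quotv_class u + quotv_class v.
Proof. by rewrite /quotv_class raddfD. Qed.

Lemma quotv_repr_class v : quotv_repr (quotv_class v) - v \in U.
Proof. by apply/quotv_classP; rewrite quotv_reprK. Qed.

Definition quotv_scale (k : K) (q : Q) : Q := quotv_class (k *: quotv_repr q).

Lemma quotv_classZ k v : quotv_class (k *: v) = quotv_scale k (quotv_class v).
Proof.
apply/esym/quotv_classP.
by rewrite -scalerBr memvZ // quotv_repr_class.
Qed.

Fact quotv_scaleA a b q : quotv_scale a (quotv_scale b q) = quotv_scale (a * b) q.
Proof. by rewrite -[q]quotv_reprK -!quotv_classZ scalerA. Qed.

Fact quotv_scale1 : left_id 1 quotv_scale.
Proof. by move=> q; rewrite -[q]quotv_reprK -quotv_classZ scale1r. Qed.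

Fact quotv_scaleDr : right_distributive quotv_scale +%R.
Proof.
move=> a q r; rewrite -[q]quotv_reprK -[r]quotv_reprK -quotv_classD.
by rewrite -!quotv_classZ scalerDr quotv_classD.
Qed.

Fact quotv_scaleDl q : {morph quotv_scale^~ q : a b / a + b}.
Proof.
by move=> a b; rewrite -[q]quotv_reprK -!quotv_classZ scalerDl quotv_classD.
Qed.

HB.instance Definition _ := GRing.Zmodule_isLmodule.Build K Q
  quotv_scaleA quotv_scale1 quotv_scaleDr quotv_scaleDl.

Fact quotv_class_is_linear : linear quotv_class.
Proof. by move=> a u v; rewrite quotv_classD quotv_classZ. Qed.
HB.instance Definition _ :=
  GRing.isLinear.Build K V Q _ quotv_class quotv_class_is_linear.

(* Coordinates of a coset are those of its representative in the complement
   U^C. *)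
Fact quotv_vect_iso : Vector.axiom (dim (subvs_of U^C)) Q.
Proof.
pose p (v : V) : subvs_of U^C := vsproj U^C (v - projv U v).
have pU v : vsval (p v) = v - projv U v by rewrite vsprojK ?memv_projC.
have p_lin : linear p.
  move=> a u v; apply/subvs_inj; rewrite linearP /= !pU linearP /=.
  by rewrite scalerBr opprD addrACA.
pose pL : {linear V -> subvs_of U^C} :=
  HB.pack p (GRing.isLinear.Build K V (subvs_of U^C) _ p p_lin).
have p0 v : v \in U -> p v = 0.
  by move=> vU; apply/subvs_inj; rewrite pU projv_id ?subrr.
have pq v : p (quotv_repr (quotv_class v)) = p v.
  by apply/eqP; rewrite -subr_eq0 -(linearB pL) /= p0 ?quotv_repr_class.
exists (fun q => v2r (p (quotv_repr q))).
  move=> a q r; rewrite -[in LHS](quotv_reprK q) -[in LHS](quotv_reprK r).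
  by rewrite -linearP pq p_lin linearP.
exists (fun r => quotv_class (vsval (r2v r : subvs_of U^C))) => [q | r].
  rewrite v2rK pU -[RHS]quotv_reprK; apply/quotv_classP.
  by rewrite addrAC subrr sub0r memvN memv_proj.
rewrite pq -[RHS]r2vK; congr v2r; apply/subvs_inj; rewrite pU.
set w := r2v r; suff -> : projv U (vsval w) = 0 by rewrite subr0.
have wC := subvsP w; have := memv_projC U (vsval w).
move=> h; have : projv U (vsval w) \in (U :&: U^C)%VS.
  rewrite memv_cap memv_proj /= -[projv _ _](subKr (vsval w)).
  exact: memvB.
by rewrite capv_compl memv0 => /eqP.
Qed.

HB.instance Definition _ := Lmodule_hasFinDim.Build K Q quotv_vect_iso.

Definition quotv_pi : 'Hom(V, Q) := linfun quotv_class.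

Lemma quotv_piK v : quotv_pi (quotv_repr v) = v.
Proof. by rewrite lfunE /= quotv_reprK. Qed.

Lemma limg_quotv_pi : limg quotv_pi = fullv.
Proof.
apply/vspaceP=> q; rewrite memvf.
by apply/memv_imgP; exists (quotv_repr q); rewrite ?memvf ?quotv_piK.
Qed.

Lemma lker_quotv_pi : lker quotv_pi = U.
Proof.
apply/vspaceP=> v; rewrite memv_ker lfunE /=.
rewrite -[X in X \in U]subr0; apply/eqP/quotv_classP.
  by move=> ->; rewrite linear0.
by move=> ->; rewrite linear0.
Qed.

End QuotientSpace.

(* The map V/U -> V'/U' induced by f; the choice of linear section of the
   projection is irrelevant when f maps U into U', see quotv_mapE. *)
Definition quotv_map (K : fieldType) (V V' : vectType K) (U : {vspace V})
    (U' : {vspace V'}) (f : 'Hom(V, V')) : 'Hom(quotv U, quotv U') :=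
  (quotv_pi U' \o f \o (quotv_pi U)^-1)%VF.

Lemma quotv_mapE (K : fieldType) (V V' : vectType K) (U : {vspace V})
    (U' : {vspace V'}) (f : 'Hom(V, V')) v :
  (f @: U <= U')%VS -> quotv_map U U' f (quotv_pi U v) = quotv_pi U' (f v).
Proof.
move=> fU; rewrite /quotv_map !comp_lfunE /=.
apply/eqP; rewrite -subr_eq0 -!linearB /= -memv_ker lker_quotv_pi.
apply: (subvP fU); apply: memv_img.
set w := _ - v; suff : w \in lker (quotv_pi U) by rewrite lker_quotv_pi.
by rewrite memv_ker linearB /= limg_lfunVK ?subrr ?memv_img ?memvf.
Qed.

(* The map S -> T between subspaces obtained by restricting f, when f maps S
   into T, see subvs_mapE. *)
Definition subvs_map (K : fieldType) (V V' : vectType K) (S : {vspace V})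
    (T : {vspace V'}) (f : 'Hom(V, V')) : 'Hom(subvs_of S, subvs_of T) :=
  (linfun (vsproj T) \o f \o linfun vsval)%VF.

Lemma subvs_mapE (K : fieldType) (V V' : vectType K) (S : {vspace V})
    (T : {vspace V'}) (f : 'Hom(V, V')) v :
  (f @: S <= T)%VS -> vsval (subvs_map S T f v) = f (vsval v).
Proof.
move=> fS; rewrite /subvs_map !comp_lfunE !lfunE /= vsprojK //.
by apply: (subvP fS); apply/memv_img/subvsP.
Qed.

Definition dsum (K : fieldType) (I : finType) (V : I -> vectType K) : Type :=
  {dffun forall i, V i}.

Section DirectSum.
Variables (K : fieldType) (I : finType) (V : I -> vectType K).
Local Notation S := (dsum V).

HB.instance Definition _ := Choice.copy S {dffun forall i, V i}.

Definition dsum_mk (f : forall i, V i) : S := finfun f.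
Definition dsum_nth (i : I) (m : S) : V i := m i.

Lemma dsum_nthE i f : dsum_nth i (dsum_mk f) = f i.
Proof. exact: ffunE. Qed.

Lemma dsumP (m m' : S) : (forall i, dsum_nth i m = dsum_nth i m') <-> m = m'.
Proof. by split=> [h | -> //]; apply/ffunP. Qed.

Definition dsum_zero : S := dsum_mk (fun => 0).
Definition dsum_opp (m : S) : S := dsum_mk (fun i => - dsum_nth i m).
Definition dsum_add (m m' : S) : S :=
  dsum_mk (fun i => dsum_nth i m + dsum_nth i m').
Definition dsum_scale (k : K) (m : S) : S := dsum_mk (fun i => k *: dsum_nth i m).

Fact dsum_addA : associative dsum_add.
Proof. by move=> x y z; apply/dsumP=> i; rewrite !dsum_nthE addrA. Qed.
Fact dsum_addC : commutative dsum_add.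
Proof. by move=> x y; apply/dsumP=> i; rewrite !dsum_nthE addrC. Qed.
Fact dsum_add0 : left_id dsum_zero dsum_add.
Proof. by move=> x; apply/dsumP=> i; rewrite !dsum_nthE add0r. Qed.
Fact dsum_addN : left_inverse dsum_zero dsum_opp dsum_add.
Proof. by move=> x; apply/dsumP=> i; rewrite !dsum_nthE addNr. Qed.

HB.instance Definition _ := GRing.isZmodule.Build S
  dsum_addA dsum_addC dsum_add0 dsum_addN.

Fact dsum_scaleA a b m : dsum_scale a (dsum_scale b m) = dsum_scale (a * b) m.
Proof. by apply/dsumP=> i; rewrite !dsum_nthE scalerA. Qed.
Fact dsum_scale1 : left_id 1 dsum_scale.
Proof. by move=> m; apply/dsumP=> i; rewrite !dsum_nthE scale1r. Qed.
Fact dsum_scaleDr : right_distributive dsum_scale +%R.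
Proof. by move=> a m m'; apply/dsumP=> i; rewrite !dsum_nthE scalerDr. Qed.
Fact dsum_scaleDl m : {morph dsum_scale^~ m : a b / a + b}.
Proof. by move=> a b; apply/dsumP=> i; rewrite !dsum_nthE scalerDl. Qed.

HB.instance Definition _ := GRing.Zmodule_isLmodule.Build K S
  dsum_scaleA dsum_scale1 dsum_scaleDr dsum_scaleDl.

Fact dsum_nth_is_linear i : linear (dsum_nth i).
Proof. by move=> a m m'; rewrite !dsum_nthE. Qed.
HB.instance Definition _ i :=
  GRing.isLinear.Build K S (V i) _ (dsum_nth i) (dsum_nth_is_linear i).

Fact dsum_vect_iso : Vector.axiom #|{: {i : I & 'I_(dim (V i))}}| S.
Proof.
pose T := {i : I & 'I_(dim (V i))}.
pose crd (m : S) (t : T) : K := v2r (dsum_nth (tag t) m) 0 (tagged t).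
pose f (m : S) : 'rV[K]_#|{: T}| := \row_k crd m (enum_val k).
pose g (r : 'rV[K]_#|{: T}|) : S := dsum_mk (fun i =>
  r2v (\row_j r 0 (enum_rank (Tagged (fun i => 'I_(dim (V i))) j)))).
exists f.
  by move=> a m m'; apply/rowP=> k; rewrite !mxE /crd !linearP !mxE.
exists g => [m | r].
  apply/dsumP=> i; rewrite dsum_nthE -[RHS]v2rK; congr r2v.
  by apply/rowP=> j; rewrite !mxE enum_rankK.
apply/rowP=> k; rewrite mxE /crd dsum_nthE r2vK mxE; congr (r 0 _).
by rewrite -[RHS]enum_valK; congr enum_rank; case: (enum_val k).
Qed.

HB.instance Definition _ := Lmodule_hasFinDim.Build K S dsum_vect_iso.

Definition dsum_single (i : I) (v : V i) : S :=
  dsum_mk (dfwith (fun j => 0 : V j) v).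

Fact dsum_single_is_linear i : linear (@dsum_single i).
Proof.
move=> a u v; apply/dsumP=> j; rewrite linearP /= !dsum_nthE.
have [<- | ij] := eqVneq i j; first by rewrite !dfwith_in.
by rewrite !dfwith_out // scaler0 addr0.
Qed.
HB.instance Definition _ i :=
  GRing.isLinear.Build K (V i) S _ (@dsum_single i) (@dsum_single_is_linear i).

Definition dsum_in (i : I) : 'Hom(V i, S) := linfun (@dsum_single i).
Definition dsum_proj (i : I) : 'Hom(S, V i) := linfun (dsum_nth i).

Lemma dsum_sumE (m : S) : \sum_i dsum_in i (dsum_proj i m) = m.
Proof.
apply/dsumP=> j; rewrite raddf_sum (bigD1 j) //= big1 => [|i ij].
  by rewrite !lfunE /= dsum_nthE dfwith_in addr0.
by rewrite !lfunE /= dsum_nthE dfwith_out.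
Qed.

End DirectSum.

(* Differentials are given between all pairs of degrees, and vanish unless the
   degree drops by one, so that no transport along n + 1 - 1 = n is needed. *)
Record chain_complex (K : fieldType) := ChainComplex {
  chain_grp :> int -> vectType K;
  chain_d : forall i j, 'Hom(chain_grp i, chain_grp j);
  chain_dN0 : forall i j, chain_d i j != 0 -> i = j + 1;
  chain_dd : forall i j k, (chain_d j k \o chain_d i j)%VF = 0 }.

Record subcomplex (K : fieldType) (C : chain_complex K) := Subcomplex {
  subc_grp :> forall n, {vspace C n};
  subc_d : forall i j, (chain_d C i j @: subc_grp i <= subc_grp j)%VS }.

Definition subc_le (K : fieldType) (C : chain_complex K) (S T : subcomplex C) :=
  forall n, (S n <= T n)%VS.

Section Homology.
Variable K : fieldType.
Implicit Types C D : chain_complex K.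

Section SubQuotient.
Variables (C : chain_complex K) (S T : subcomplex C).

Definition sub_d i j : 'Hom(subvs_of (S i), subvs_of (S j)) :=
  subvs_map (S i) (S j) (chain_d C i j).

Fact sub_dN0 i j : sub_d i j != 0 -> i = j + 1.
Proof.
move=> dn0; apply: (@chain_dN0 _ C); apply: contraNneq dn0 => d0.
by rewrite /sub_d /subvs_map d0 comp_lfun0r comp_lfun0l.
Qed.

Fact sub_dd i j k : (sub_d j k \o sub_d i j)%VF = 0.
Proof.
apply/lfunP=> v; apply/subvs_inj.
by rewrite comp_lfunE !subvs_mapE ?subc_d // -comp_lfunE chain_dd !lfunE.
Qed.

Definition sub_complex : chain_complex K :=
  @ChainComplex K (fun n => subvs_of (S n)) sub_d sub_dN0 sub_dd.

Definition quot_d i j : 'Hom(quotv (S i), quotv (S j)) :=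
  quotv_map (S i) (S j) (chain_d C i j).

Fact quot_dN0 i j : quot_d i j != 0 -> i = j + 1.
Proof.
move=> dn0; apply: (@chain_dN0 _ C); apply: contraNneq dn0 => d0.
by rewrite /quot_d /quotv_map d0 comp_lfun0r comp_lfun0l.
Qed.

Fact quot_dd i j k : (quot_d j k \o quot_d i j)%VF = 0.
Proof.
apply/lfunP=> v; rewrite comp_lfunE -(quotv_piK v) !quotv_mapE ?subc_d //.
by rewrite -[chain_d C j k _]comp_lfunE chain_dd !lfunE /= linear0.
Qed.

Definition quot_complex : chain_complex K :=
  @ChainComplex K (fun n => quotv (S n)) quot_d quot_dN0 quot_dd.

(* T as a subcomplex of S, i.e. the intersection of S and T *)
Definition restr_grp n : {vspace sub_complex n} := (linfun vsval @^-1: T n)%VS.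

Fact restr_d i j : (chain_d sub_complex i j @: restr_grp i <= restr_grp j)%VS.
Proof.
apply/subvP=> _ /memv_imgP[v vT ->]; rewrite -memv_preim lfunE /=.
rewrite subvs_mapE ?subc_d //; apply: (subvP (subc_d T i j)); apply: memv_img.
by move: vT; rewrite -memv_preim lfunE.
Qed.

Definition restr_subcomplex : subcomplex sub_complex := Subcomplex restr_d.

End SubQuotient.

Definition cycles C (n : int) : {vspace C n} := lker (chain_d C n (n - 1)).

Definition boundaries C (n : int) : {vspace subvs_of (cycles C n)} :=
  (linfun vsval @^-1: limg (chain_d C (n + 1) n))%VS.

Definition homology C (n : int) : vectType K := quotv (boundaries C n).

(* homology of the quotient of S by its subcomplex T; used with T <= S only *)
Definition relative_homology C (S T : subcomplex C) (n : int) : vectType K :=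
  homology (quot_complex (restr_subcomplex S T)) n.

Record chain_map C D := ChainMap {
  chain_fun :> forall n, 'Hom(C n, D n);
  chain_funC : forall i j,
    (chain_fun j \o chain_d C i j = chain_d D i j \o chain_fun i)%VF }.

Definition homology_map C D (f : chain_map C D) (n : int) :
    'Hom(homology C n, homology D n) :=
  quotv_map (boundaries C n) (boundaries D n)
    (subvs_map (cycles C n) (cycles D n) (f n)).

Section HomologyMapE.
Variables (C D : chain_complex K) (f : chain_map C D) (n : int).

Fact chain_fun_cycles : (f n @: cycles C n <= cycles D n)%VS.
Proof.
apply/subvP=> _ /memv_imgP[v vZ ->]; move: vZ.
rewrite !memv_ker => /eqP dv.
by rewrite -comp_lfunE -chain_funC comp_lfunE dv linear0.
Qed.

Lemma homology_mapE z :
  homology_map f n (quotv_pi (boundaries C n) z) =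
  quotv_pi (boundaries D n) (subvs_map (cycles C n) (cycles D n) (f n) z).
Proof.
apply: quotv_mapE; apply/subvP=> _ /memv_imgP[v vB ->].
move: vB; rewrite -!memv_preim ![linfun vsval _]lfunE.
rewrite [X in _ -> X \in _]subvs_mapE ?chain_fun_cycles //=.
case/memv_imgP=> w _ ->.
by rewrite -comp_lfunE chain_funC comp_lfunE memv_img ?memvf.
Qed.

End HomologyMapE.

Section Inclusion.
Variables (C : chain_complex K) (S T : subcomplex C) (leST : subc_le S T).

Definition incl_fun n : 'Hom(sub_complex S n, sub_complex T n) :=
  subvs_map (S n) (T n) \1%VF.

Fact incl_funE n v : vsval (incl_fun n v) = vsval v.
Proof. by rewrite /incl_fun subvs_mapE ?lim1g ?leST // id_lfunE. Qed.

Fact incl_funC i j :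
  (incl_fun j \o chain_d (sub_complex S) i j
     = chain_d (sub_complex T) i j \o incl_fun i)%VF.
Proof.
apply/lfunP=> v; apply/subvs_inj; rewrite 2!comp_lfunE.
rewrite [LHS]incl_funE [LHS]subvs_mapE ?subc_d //.
by rewrite [RHS]subvs_mapE ?subc_d // incl_funE.
Qed.

Definition inclusion : chain_map (sub_complex S) (sub_complex T) :=
  ChainMap incl_funC.

End Inclusion.

End Homology.

Record filtered_complex (K : fieldType) (d : Order.disp_t) (L : porderType d) :=
  FilteredComplex {
    filt_complex :> chain_complex K;
    filt_sub : L -> subcomplex filt_complex;
    filt_le : forall a b : L, (a <= b)%O -> subc_le (filt_sub a) (filt_sub b) }.

Section Filtered.
Variables (K : fieldType) (d : Order.disp_t) (L : porderType d).
Implicit Types F G : filtered_complex K L.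

Definition filtered_map F G (f : forall n, 'Hom(F n, G n)) : Prop :=
  forall a n, (f n @: filt_sub F a n <= filt_sub G a n)%VS.

(* A homotopy is a map of degree +1, represented as the differentials are. *)
Definition filtered_homotopic F G (f g : forall n, 'Hom(F n, G n)) : Prop :=
  exists h : forall i j, 'Hom(F i, G j),
    [/\ forall i j, h i j != 0 -> j = i + 1,
        forall a i j, (h i j @: filt_sub F a i <= filt_sub G a j)%VS
      & forall n, f n - g n = (chain_d G (n + 1) n \o h n (n + 1))%VF
                            + (h (n - 1) n \o chain_d F n (n - 1))%VF].

Definition filtered_chain_equivalent F G : Prop :=
  exists (f : chain_map F G) (g : chain_map G F),
    [/\ filtered_map f, filtered_map g,
        filtered_homotopic (fun n => (g n \o f n)%VF) (fun n => \1%VF)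
      & filtered_homotopic (fun n => (f n \o g n)%VF) (fun n => \1%VF)].

Definition persistent_homology F (a b : L) (leab : (a <= b)%O) (n : int) :
    {vspace homology (sub_complex (filt_sub F b)) n} :=
  limg (homology_map (inclusion (filt_le F leab)) n).

End Filtered.

Record cell_complex (K : fieldType) (d : Order.disp_t) (X : finPOrderType d) :=
  CellComplex {
    cell_dim : X -> nat;
    cell_kappa : X -> X -> K;
    cell_dim_homo : forall x y : X, (x <= y)%O -> (cell_dim x <= cell_dim y)%N;
    cell_kappaN0 : forall x y : X, cell_kappa x y != 0 ->
      (y <= x)%O /\ cell_dim x = (cell_dim y).+1;
    cell_kappa2 : forall x z : X, \sum_y cell_kappa x y * cell_kappa y z = 0 }.

Record closed_cells (d : Order.disp_t) (X : finPOrderType d) := ClosedCells {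
  closed_set :> {set X};
  closed_setP : forall x y : X, (y <= x)%O -> x \in closed_set -> y \in closed_set }.

Section CellChains.
Variables (K : fieldType) (d : Order.disp_t) (X : finPOrderType d).
Variable cX : cell_complex K X.

Definition cells (n : int) := {x : X | (cell_dim cX x)%:Z == n}.

Definition cell_grp (n : int) : vectType K := {ffun cells n -> K^o}.

Definition cell_vec (n : int) (x : cells n) : cell_grp n :=
  [ffun y => (y == x)%:R].

Lemma cell_vec_sum n (c : cell_grp n) : c = \sum_x c x *: cell_vec x.
Proof.
apply/ffunP=> y; rewrite sum_ffunE (bigD1 y) //= big1 => [|x xy].
  by rewrite !ffunE eqxx addr0 /GRing.scale /= mulr1.
by rewrite !ffunE eq_sym (negPf xy) scaler0.
Qed.

Definition cell_d_fun (i j : int) (c : cell_grp i) : cell_grp j :=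
  \sum_x c x *: \sum_y cell_kappa cX (val x) (val y) *: cell_vec y.

Fact cell_d_fun_is_linear i j : linear (@cell_d_fun i j).
Proof.
move=> a u v; rewrite /cell_d_fun scaler_sumr -big_split /=.
by apply: eq_bigr => x _; rewrite !ffunE scalerDl scalerA.
Qed.
HB.instance Definition _ i j := GRing.isLinear.Build K (cell_grp i) (cell_grp j)
  _ (@cell_d_fun i j) (@cell_d_fun_is_linear i j).

Definition cell_d (i j : int) : 'Hom(cell_grp i, cell_grp j) :=
  linfun (@cell_d_fun i j).

Lemma cell_d_vec i j (x : cells i) :
  cell_d i j (cell_vec x) =
  \sum_(y : cells j) cell_kappa cX (val x) (val y) *: cell_vec y.
Proof.
rewrite lfunE /= /cell_d_fun (bigD1 x) //= [X in _ + X]big1 => [|z zx].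
  by rewrite ffunE eqxx scale1r addr0.
by rewrite ffunE (negPf zx) scale0r.
Qed.

Fact cell_dN0 i j : cell_d i j != 0 -> i = j + 1.
Proof.
apply: contra_neq_eq => ij; apply/lfunP=> c; rewrite !lfunE /= /cell_d_fun.
apply: big1 => x _; rewrite big1 ?scaler0 // => y _.
have [-> | /cell_kappaN0[_ dxy]] := eqVneq (cell_kappa cX (val x) (val y)) 0.
  by rewrite scale0r.
case/eqP: ij; rewrite -(eqP (valP x)) -(eqP (valP y)) dxy.
by rewrite -addn1 PoszD.
Qed.

Fact cell_dd i j k : (cell_d j k \o cell_d i j)%VF = 0.
Proof.
have [d0 | /cell_dN0 ij] := eqVneq (cell_d i j) 0.
  by rewrite d0 comp_lfun0r.
apply/lfunP=> c; rewrite comp_lfunE [RHS]lfunE /= [c]cell_vec_sum.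
rewrite !linear_sum /= big1 // => x _; rewrite !linearZ /=.
rewrite cell_d_vec linear_sum /=.
under eq_bigr => y _ do rewrite linearZ /= cell_d_vec scaler_sumr.
rewrite exchange_big /= big1 ?scaler0 // => z _.
under eq_bigr => y _ do rewrite scalerA.
rewrite -scaler_suml; set s := (X in X *: _); suff -> : s = 0 by rewrite scale0r.
rewrite -[RHS](cell_kappa2 cX (val x) (val z)).
rewrite [RHS](bigID (fun y => (cell_dim cX y)%:Z == j)) /= [X in _ + X]big1.
  rewrite addr0 (reindex_omap (val : cells j -> X) insub) => [|y yj].
    by apply: eq_bigl => y; rewrite (valP y) valK eqxx.
  by rewrite insubT.
move=> y yj; have [-> | /cell_kappaN0[_ dxy]] := eqVneq (cell_kappa cX (val x) y) 0.
  by rewrite mul0r.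
case/eqP: yj; apply: (addIr 1); rewrite -ij -(eqP (valP x)) dxy.
by rewrite -addn1 PoszD.
Qed.

Definition cell_chains : chain_complex K := ChainComplex cell_dN0 cell_dd.

Definition closed_grp (A : closed_cells X) n : {vspace cell_chains n} :=
  <<[seq cell_vec x | x in [pred x : cells n | val x \in A]]>>%VS.

Fact closed_grp_d (A : closed_cells X) i j :
  (chain_d cell_chains i j @: closed_grp A i <= closed_grp A j)%VS.
Proof.
rewrite limg_span; apply/span_subvP=> _ /mapP[_ /imageP[x xA ->] ->].
rewrite inE in xA; rewrite /= cell_d_vec; apply: memv_suml => y _.
have [-> | /cell_kappaN0[yx _]] := eqVneq (cell_kappa cX (val x) (val y)) 0.
  by rewrite scale0r mem0v.
apply/memvZ/memv_span/image_f.
by rewrite inE (closed_setP yx xA).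
Qed.

Definition closed_chains (A : closed_cells X) : subcomplex cell_chains :=
  Subcomplex (@closed_grp_d A).

Fact closed_chains_le (A B : closed_cells X) :
  A \subset B -> subc_le (closed_chains A) (closed_chains B).
Proof.
move=> /subsetP AB n; apply: sub_span => _ /imageP[x xA ->].
by apply: image_f; move: xA; rewrite !inE => /AB.
Qed.

Definition cell_homology (A B : closed_cells X) (n : int) : vectType K :=
  relative_homology (closed_chains A) (closed_chains B) n.

End CellChains.

Section JoinIrreducible.
Variables (d : Order.disp_t) (L : finTBDistrLatticeType d).
Local Open Scope order_scope.

Definition covers (a b : L) : bool :=
  (b < a) && [forall c : L, ~~ ((b < c) && (c < a))].

Definition join_irreducible (a : L) : bool := #|[set b | covers a b]| == 1%N.

Definition joinirr := {a : L | join_irreducible a}.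

(* The default value \bot is never used, see predecessorP. *)
Definition predecessor (p : joinirr) : L :=
  odflt \bot [pick b | covers (val p) b].

Lemma predecessorP (p : joinirr) b : covers (val p) b = (b == predecessor p).
Proof.
have /cards1P[c Ec] := valP p.
have cE x : covers (val p) x = (x == c).
  by move/setP/(_ x): Ec; rewrite !inE.
rewrite cE /predecessor; case: pickP => [x | /(_ c)]; rewrite cE.
  by move/eqP->.
by rewrite eqxx.
Qed.

End JoinIrreducible.

Record cell_lattice (dX : Order.disp_t) (X : finPOrderType dX)
    (dL : Order.disp_t) (L : finTBDistrLatticeType dL) := CellLattice {
  cell_latt :> L -> closed_cells X;
  cell_latt0 : cell_latt \bot%O = set0 :> {set X};
  cell_latt1 : cell_latt \top%O = [set: X] :> {set X};
  cell_lattI : forall a b : L,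
    cell_latt (a `&` b)%O = cell_latt a :&: cell_latt b :> {set X};
  cell_lattU : forall a b : L,
    cell_latt (a `|` b)%O = cell_latt a :|: cell_latt b :> {set X};
  cell_latt_inj : injective (fun a => cell_latt a : {set X}) }.

Section ConnectionMatrix.
Variables (K : fieldType) (dX : Order.disp_t) (X : finPOrderType dX).
Variable cX : cell_complex K X.
Variables (dL : Order.disp_t) (L : finTBDistrLatticeType dL).
Variable XL : cell_lattice X L.

Local Notation J := (joinirr L).

Fact cell_filt_le (a b : L) : (a <= b)%O ->
  subc_le (closed_chains cX (XL a)) (closed_chains cX (XL b)).
Proof.
move=> /meet_idPl ab; apply: closed_chains_le.
by rewrite -ab cell_lattI subsetIr.
Qed.

Definition cell_filtration : filtered_complex K L :=
  @FilteredComplex K dL L (cell_chains cX) (fun a => closed_chains cX (XL a))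
    cell_filt_le.

Definition conn_summand (n : int) (p : J) : vectType K :=
  cell_homology cX (XL (val p)) (XL (predecessor p)) n.

Definition conn_grp (n : int) : vectType K := dsum (conn_summand n).

Definition conn_in n (p : J) : 'Hom(conn_summand n p, conn_grp n) :=
  dsum_in (conn_summand n) p.

Definition conn_comp (i j : int) (D : 'Hom(conn_grp i, conn_grp j)) (p q : J) :
    'Hom(conn_summand i q, conn_summand j p) :=
  (dsum_proj (conn_summand j) p \o D \o conn_in i q)%VF.

Section Complex.
Variable D : forall i j, 'Hom(conn_grp i, conn_grp j).
Hypothesis D_deg : forall i j, D i j != 0 -> i = j + 1.
Hypothesis D_D : forall i j k, (D j k \o D i j)%VF = 0.
Hypothesis D_filt : forall i j p q,
  conn_comp (D i j) p q != 0 -> (val p <= val q)%O.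

Definition conn_complex_of : chain_complex K := ChainComplex D_deg D_D.

Definition conn_sub_grp (a : L) n : {vspace conn_complex_of n} :=
  (\sum_(b : J | (val b <= a)%O) limg (conn_in n b))%VS.

Fact conn_sub_d a i j :
  (chain_d conn_complex_of i j @: conn_sub_grp a i <= conn_sub_grp a j)%VS.
Proof.
rewrite limg_sum; apply/subv_sumP => q qa.
apply/subvP=> _ /memv_imgP[_ /memv_imgP[v _ ->] ->] /=.
rewrite -[D i j _]dsum_sumE; apply: memv_suml => p _.
rewrite -[dsum_proj _ _ _]comp_lfunE -[_ (conn_in _ _ _)]comp_lfunE.
rewrite -/(conn_comp (D i j) p q).
have [-> | /D_filt pq] := eqVneq (conn_comp (D i j) p q) 0.
  by rewrite zero_lfunE linear0 mem0v.
apply: (subvP (sumv_sup p (le_trans pq qa) (subvv _))).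
exact: memv_img (memvf _).
Qed.

Definition conn_sub a : subcomplex conn_complex_of := Subcomplex (@conn_sub_d a).

Fact conn_sub_le (a b : L) : (a <= b)%O -> subc_le (conn_sub a) (conn_sub b).
Proof.
move=> ab n; apply/subv_sumP => p pa /=.
exact: (sumv_sup p) (le_trans pa ab) (subvv _).
Qed.

Definition conn_filtration_of : filtered_complex K L :=
  FilteredComplex conn_sub_le.

End Complex.

Record connection_matrix := ConnectionMatrix {
  conn_d :> forall i j, 'Hom(conn_grp i, conn_grp j);
  conn_dN0 : forall i j, conn_d i j != 0 -> i = j + 1;
  conn_dd : forall i j k, (conn_d j k \o conn_d i j)%VF = 0;
  conn_filtered : forall i j p q,
    conn_comp (conn_d i j) p q != 0 -> (val p <= val q)%O;
  conn_strict : forall i j p, conn_comp (conn_d i j) p p = 0;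
  conn_equiv : filtered_chain_equivalent
    (conn_filtration_of conn_dN0 conn_dd conn_filtered) cell_filtration }.

Definition conn_filtration (D : connection_matrix) : filtered_complex K L :=
  conn_filtration_of (@conn_dN0 D) (@conn_dd D) (@conn_filtered D).

End ConnectionMatrix.

(* Main.v *)
Require Import Defs.
From HB Require Import structures.
From mathcomp Require Import all_boot all_order all_algebra.

Set Implicit Arguments.
Unset Strict Implicit.
Unset Printing Implicit Defensive.

Import GRing.Theory.
Local Open Scope ring_scope.

(** A connection matrix comes with an [L]-filtered chain equivalence between
    [(M, Delta)] and [C(X)], and persistent homology is an invariant of filtered
    chain equivalence ([persistent_homology_invariant]). Filtered chain
    maps and homotopies restrict to the subcomplexes indexed by each [a] in [L], so the equivalence restricts to a chain equivalence at
    every level ([filtered_homology_mapK]). The resulting isomorphisms on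
    homology commute with the maps induced by inclusions, because on chains both
    composites are restrictions of the same map ([inclusion_homology_natural]).
    A commutative square whose vertical maps are isomorphisms identifies the
    images of its horizontal maps ([limg_isomorphic]); for the square at
    [a <= b] these images are the persistent homology groups. *)

(** The maps [g] and [g'] restrict to inverse bijections of the images. That
    [g'] sends [limg i'] back into [limg i] rests on [f] being onto. *)
Lemma limg_isomorphic (K : fieldType) (U U' W W' : vectType K)
    (i : 'Hom(U, W)) (i' : 'Hom(U', W'))
    (f : 'Hom(U, U')) (f' : 'Hom(U', U)) (g : 'Hom(W, W')) (g' : 'Hom(W', W)) :
  cancel f' f -> cancel g g' -> cancel g' g -> (forall u, g (i u) = i' (f u)) ->
  isomorphic (subvs_of (limg i)) (subvs_of (limg i')).
Proof.
move=> f'K gK g'K gi.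
have gS : (g @: limg i <= limg i')%VS.
  apply/subvP=> _ /memv_imgP[_ /memv_imgP[u _ ->] ->].
  by rewrite gi memv_img ?memvf.
have g'S : (g' @: limg i' <= limg i)%VS.
  apply/subvP=> _ /memv_imgP[_ /memv_imgP[u _ ->] ->].
  by rewrite -[u]f'K -gi gK memv_img ?memvf.
exists (subvs_map (limg i) (limg i') g).
exists (subvs_map (limg i') (limg i) g') => v; apply/subvs_inj;
  by rewrite !subvs_mapE.
Qed.

Section HomologyFunctor.
Variable K : fieldType.
Implicit Types C D E : chain_complex K.

Fact id_chain_funC C i j :
  (\1 \o chain_d C i j = chain_d C i j \o \1)%VF.
Proof. by rewrite comp_lfun1l comp_lfun1r. Qed.

Definition id_chain_map C : chain_map C C :=
  @ChainMap K C C (fun=> \1%VF) (@id_chain_funC C).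

Fact comp_chain_funC C D E (g : chain_map D E) (f : chain_map C D) i j :
  ((g j \o f j) \o chain_d C i j = chain_d E i j \o (g i \o f i))%VF.
Proof.
by rewrite -comp_lfunA chain_funC comp_lfunA chain_funC -comp_lfunA.
Qed.

Definition comp_chain_map C D E (g : chain_map D E) (f : chain_map C D) :
    chain_map C E :=
  ChainMap (comp_chain_funC g f).

Fact comp_chain_mapE C D E (g : chain_map D E) (f : chain_map C D) n v :
  comp_chain_map g f n v = g n (f n v).
Proof. exact: comp_lfunE. Qed.

Definition chain_homotopic C D (f g : forall n, 'Hom(C n, D n)) : Prop :=
  exists h : forall i j, 'Hom(C i, D j), forall n,
    f n - g n = (chain_d D (n + 1) n \o h n (n + 1))%VF
              + (h (n - 1) n \o chain_d C n (n - 1))%VF.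

Lemma homology_map_id C n x : homology_map (id_chain_map C) n x = x.
Proof.
rewrite -[x]quotv_piK homology_mapE; congr (fun_of_lfun _ _); apply/subvs_inj.
by rewrite subvs_mapE ?id_lfunE //; apply: (chain_fun_cycles (id_chain_map C)).
Qed.

Lemma homology_map_comp C D E (g : chain_map D E) (f : chain_map C D) n x :
  homology_map (comp_chain_map g f) n x = homology_map g n (homology_map f n x).
Proof.
rewrite -[x]quotv_piK !homology_mapE; congr (fun_of_lfun _ _); apply/subvs_inj.
rewrite subvs_mapE; last exact: (chain_fun_cycles (comp_chain_map g f)).
by rewrite !subvs_mapE ?chain_fun_cycles // comp_chain_mapE.
Qed.

(** On a cycle [z] the term [h (d z)] of the homotopy formula vanishes, so the
    two images of [z] differ by the boundary [d (h z)]. *)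
Lemma homology_map_homotopic C D (f g : chain_map C D) n :
  chain_homotopic f g -> homology_map f n = homology_map g n.
Proof.
case=> h fg; apply/lfunP=> x; rewrite -[x]quotv_piK !homology_mapE.
set z := quotv_repr x.
have /eqP dz : chain_d C n (n - 1) (vsval z) == 0.
  by rewrite -memv_ker (subvsP z).
apply/eqP; rewrite -subr_eq0 -linearB -memv_ker lker_quotv_pi.
rewrite -memv_preim lfunE [X in X \in _]linearB /= !subvs_mapE ?chain_fun_cycles //.
rewrite -opp_lfunE -add_lfunE fg add_lfunE !comp_lfunE dz linear0 addr0.
exact: memv_img (memvf _).
Qed.

Lemma homology_map_ext C D (f g : chain_map C D) n :
  (forall i v, f i v = g i v) -> homology_map f n = homology_map g n.
Proof.
move=> fg; apply: homology_map_homotopic; exists (fun _ _ => 0) => i.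
rewrite comp_lfun0l comp_lfun0r addr0; apply/lfunP=> v.
by rewrite add_lfunE opp_lfunE fg subrr lfunE.
Qed.

End HomologyFunctor.

Section FilteredInvariance.
Variables (K : fieldType) (d : Order.disp_t) (L : porderType d).
Implicit Types F G : filtered_complex K L.

Section Restriction.
Variables (F G : filtered_complex K L) (f : chain_map F G).
Hypothesis f_filt : filtered_map f.
Variable a : L.

Definition filt_fun n :
    'Hom(sub_complex (filt_sub F a) n, sub_complex (filt_sub G a) n) :=
  subvs_map (filt_sub F a n) (filt_sub G a n) (f n).

Fact filt_funE n v : vsval (filt_fun n v) = f n (vsval v).
Proof. exact: subvs_mapE. Qed.

Fact filt_funC i j :
  (filt_fun j \o chain_d (sub_complex (filt_sub F a)) i j
     = chain_d (sub_complex (filt_sub G a)) i j \o filt_fun i)%VF.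
Proof.
apply/lfunP=> v; apply/subvs_inj; rewrite 2!comp_lfunE.
rewrite [LHS]filt_funE [in LHS]subvs_mapE ?subc_d //.
rewrite [RHS]subvs_mapE ?subc_d // filt_funE.
by rewrite -comp_lfunE chain_funC comp_lfunE.
Qed.

Definition filt_chain_map :
    chain_map (sub_complex (filt_sub F a)) (sub_complex (filt_sub G a)) :=
  ChainMap filt_funC.

End Restriction.

Lemma inclusion_homology_natural F G (f : chain_map F G)
    (f_filt : filtered_map f) (a b : L) (leab : (a <= b)%O) n x :
  homology_map (filt_chain_map f_filt b) n
      (homology_map (inclusion (filt_le F leab)) n x)
  = homology_map (inclusion (filt_le G leab)) n
      (homology_map (filt_chain_map f_filt a) n x).
Proof.
rewrite -!homology_map_comp; congr (fun_of_lfun _ x).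
apply: homology_map_ext => i v; apply/subvs_inj.
rewrite !comp_chain_mapE [LHS](filt_funE f_filt).
rewrite [RHS](incl_funE (filt_le G leab)) [RHS](filt_funE f_filt).
by congr (f i _); apply: (incl_funE (filt_le F leab)).
Qed.

(** Since the homotopy from [g \o f] to the identity preserves the filtration,
    it restricts to a homotopy on the subcomplex indexed by [a]. *)
Lemma filtered_homology_mapK F G (f : chain_map F G) (g : chain_map G F)
    (f_filt : filtered_map f) (g_filt : filtered_map g) (a : L) n :
  filtered_homotopic (fun n => (g n \o f n)%VF) (fun n => \1%VF) ->
  cancel (homology_map (filt_chain_map f_filt a) n)
         (homology_map (filt_chain_map g_filt a) n).
Proof.
case=> h [_ h_filt gf1] x; rewrite -homology_map_comp.
rewrite -[RHS]homology_map_id; congr (fun_of_lfun _ x).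
apply: homology_map_homotopic.
exists (fun i j => subvs_map (filt_sub F a i) (filt_sub F a j) (h i j)) => i.
apply/lfunP=> v; apply/subvs_inj.
rewrite [X in _ = vsval X]add_lfunE [X in vsval (X + _)]comp_lfunE.
rewrite [X in vsval (_ + X)]comp_lfunE linearD /=.
rewrite !subvs_mapE ?subc_d ?h_filt //.
rewrite add_lfunE opp_lfunE id_lfunE linearB /=.
rewrite [X in vsval X - _]comp_lfunE !filt_funE //.
have /lfunP/(_ (vsval v)) := gf1 i.
by rewrite !add_lfunE opp_lfunE !comp_lfunE id_lfunE.
Qed.

Theorem persistent_homology_invariant F G (a b : L) (leab : (a <= b)%O) n :
  filtered_chain_equivalent F G ->
  isomorphic (subvs_of (persistent_homology F leab n))
             (subvs_of (persistent_homology G leab n)).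
Proof.
case=> f [g [f_filt g_filt gf1 fg1]].
apply: (limg_isomorphic (f := homology_map (filt_chain_map f_filt a) n)
  (f' := homology_map (filt_chain_map g_filt a) n)
  (g := homology_map (filt_chain_map f_filt b) n)
  (g' := homology_map (filt_chain_map g_filt b) n)).
- exact: filtered_homology_mapK.
- exact: filtered_homology_mapK.
- exact: filtered_homology_mapK.
exact: inclusion_homology_natural.
Qed.

End FilteredInvariance.

Theorem theorem1p1 (K : fieldType)
    (dX : Order.disp_t) (X : finPOrderType dX) (cX : cell_complex K X)
    (dL : Order.disp_t) (L : finTBDistrLatticeType dL) (XL : cell_lattice X L)
    (Delta : connection_matrix cX XL)
    (a b : L) (leab : (a <= b)%O) (j : int) :
  isomorphic
    (subvs_of (persistent_homology (conn_filtration Delta) leab j))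
    (subvs_of (persistent_homology (cell_filtration cX XL) leab j)).
Proof. exact/persistent_homology_invariant/conn_equiv. Qed.
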